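(* Let $n$ be a positive integer and consider the game $\mathcal{D}_2=\mathcal{D}_2(1:1)$ on the edges of $K_n$ (Maker moves first). If $n\le 3$, then Maker has a winning strategy. If $n\ge 4$, then Breaker has a winning strategy.
   Context: For positive integers $a,b,d$, the $d$-diameter game $\mathcal{D}_d(a:b)$ is the following two-player, perfect-information game on the edge set of the complete graph $K_n$ on $n$ vertices. Maker and Breaker alternately claim previously unclaimed edges, Maker moving first. In each of his turns Maker claims $a$ unclaimed edges, and in each of his turns Breaker claims $b$ unclaimed edges (a player claims all remaining edges if fewer remain than he should claim). The game ends when all edges of $K_n$ are claimed. Maker wins if and only if the graph on the $n$ vertices of $K_n$ formed by Maker's edges has diameter at most $d$ (a disconnected graph has infinite diameter); otherwise Breaker wins. One writes $\mathcal{D}_d$ for $\mathcal{D}_d(1:1)$. *)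

(* Defs.v *)
From mathcomp Require Import all_boot.

Set Implicit Arguments.
Unset Strict Implicit.
Unset Printing Implicit Defensive.

(* Path of length (number of edges) at most d between any two vertices; no d
   satisfies this for a disconnected graph. *)
Definition diameter_le (T : finType) (e : rel T) (d : nat) : Prop :=
  forall u v : T, exists p : seq T, [/\ path e u p, last u p = v & size p <= d].

Definition K_edges (n : nat) : {set {set 'I_n}} := [set e : {set 'I_n} | #|e| == 2].

(* Chronological: the entry of index i is the whole set of edges claimed in
   turn i, Maker playing the turns of even index. *)
Definition history (n : nat) : Type := seq {set {set 'I_n}}.

Inductive player : Type := Maker | Breaker.

Section Game.

Variables (n a b d : nat).
Implicit Types (h : history n) (m : {set {set 'I_n}}) (P : player).

Definition to_move h : player := if odd (size h) then Breaker else Maker.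

Definition claimed h : {set {set 'I_n}} := \bigcup_(m <- h) m.

Definition free h : {set {set 'I_n}} := K_edges n :\: claimed h.

Definition maker_edges h : {set {set 'I_n}} :=
  \bigcup_(i < size h | ~~ odd i) nth set0 h i.

Definition maker_graph h : rel 'I_n :=
  [rel u v | [set u; v] \in maker_edges h].

Definition bias P : nat := if P is Maker then a else b.

Definition legal_move h m : Prop :=
  m \subset free h /\ #|m| = minn (bias (to_move h)) #|free h|.

Definition game_over h : Prop := free h = set0.

Inductive play : history n -> Prop :=
| play_start : play [::]
| play_turn h m : play h -> ~ game_over h -> legal_move h m -> play (rcons h m).

Definition wins P h : Prop :=
  if P is Maker then diameter_le (maker_graph h) d
  else ~ diameter_le (maker_graph h) d.

Definition strategy : Type := history n -> {set {set 'I_n}}.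

(* Without this condition a strategy prescribing illegal moves could be
   consistent with no complete play, hence vacuously winning. *)
Definition valid_strategy P (s : strategy) : Prop :=
  forall h, play h -> ~ game_over h -> to_move h = P -> legal_move h (s h).

Definition consistent P (s : strategy) h : Prop :=
  forall i, i < size h ->
    to_move (take i h) = P -> nth set0 h i = s (take i h).

Definition winning_strategy P (s : strategy) : Prop :=
  valid_strategy P s /\
  forall h, play h -> game_over h -> consistent P s h -> wins P h.

Definition has_winning_strategy P : Prop :=
  exists s : strategy, winning_strategy P s.

End Game.

(* Main.v *)
Require Import Defs.
From mathcomp Require Import all_boot.

(** For [n <= 3] Maker wins with any strategy: there are at most three edges, so
    Breaker gets at most one, and only when [n = 3]; the two others then form a
    path through all vertices ([diameter_le_small_play]).

    For [4 <= n] Breaker plays by pairing. Maker's first edge misses two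
    vertices [u] and [v], and Breaker answers with the edge [uv]. At this time no
    edge at [u] or [v] other than [uv] is claimed. From then on, when Maker
    claims [uw] (or [vw]), Breaker claims [vw] (or [uw]) if he still can, and
    otherwise any edge. Maker never gets both edges of such a pair: after the
    earlier of the two, the other was free and Breaker took it at once
    ([pairing_blocks]). So at the end [u] and [v] are neither adjacent nor joined
    by a path of two edges in Maker's graph.

    The two edges of a pair are exchanged by the symmetric difference with [uv],
    which lets the strategy be written without naming [u], [v] and [w]. *)

Set Implicit Arguments.
Unset Strict Implicit.
Unset Printing Implicit Defensive.

(** * Turns of a play *)

Section Turns.

Variables n a b : nat.
Implicit Types (h : history n) (e : {set 'I_n}).

Lemma claimedP h e :
  reflect (exists2 i, i < size h & e \in nth set0 h i) (e \in claimed h).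
Proof.
rewrite /claimed (big_nth set0) big_mkord.
apply: (iffP bigcupP) => [[i _ ei]|[i lt_i ei]]; first by exists i.
by exists (Ordinal lt_i).
Qed.

Lemma maker_edgesP h e :
  reflect (exists i, [/\ i < size h, ~~ odd i & e \in nth set0 h i])
          (e \in maker_edges h).
Proof.
apply: (iffP bigcupP) => [[i odd_i ei]|[i [lt_i odd_i ei]]].
  by exists i; split.
by exists (Ordinal lt_i).
Qed.

Lemma play_legal h i : play a b h -> i < size h ->
  ~ game_over (take i h) /\ legal_move a b (take i h) (nth set0 h i).
Proof.
move=> play_h; elim: play_h i => // {}h m _ IHh not_over legal i.
rewrite size_rcons ltnS leq_eqVlt => /predU1P[->|lt_i].
  by rewrite -cats1 take_size_cat // nth_cat ltnn subnn.
by rewrite -cats1 takel_cat ?(ltnW lt_i) // nth_cat lt_i; apply: IHh.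
Qed.

Lemma play_take h i : play a b h -> play a b (take i h).
Proof.
move=> play_h; elim: play_h i => [|{}h m play_h IHh not_over legal] i.
  exact: play_start.
have [lt_i|le_i] := leqP (size (rcons h m)) i.
  by rewrite take_oversize ?(ltnW lt_i) //; apply: play_turn.
move: le_i; rewrite size_rcons ltnS leq_eqVlt => /predU1P[->|lt_i].
  by rewrite -cats1 take_size_cat.
by rewrite -cats1 takel_cat ?(ltnW lt_i).
Qed.

Lemma nth_free h i j e : play a b h -> i <= j -> j < size h ->
  e \in nth set0 h j -> e \in free (take i h).
Proof.
move=> play_h le_ij lt_j ej.
have [_ [/subsetP/(_ e ej) + _]] := play_legal play_h lt_j.
rewrite !inE => /andP[unclaimed ->]; rewrite andbT.
apply: contra unclaimed => /claimedP[k + ek].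
rewrite size_take_min leq_min => /andP[lt_ki lt_k].
apply/claimedP; exists k.
  by rewrite size_take lt_j; apply: leq_trans le_ij.
by move: ek; rewrite !nth_take // (leq_trans lt_ki).
Qed.

Lemma turn_disjoint h i j e : play a b h -> i < size h -> j < size h ->
  e \in nth set0 h i -> e \in nth set0 h j -> i = j.
Proof.
move=> play_h.
suff before k l : k < l -> l < size h ->
    e \in nth set0 h k -> e \in nth set0 h l -> False.
  move=> lt_i lt_j ei ej.
  by case: (ltngtP i j) => // [/before|/before] []; move: lt_i lt_j ei ej.
move=> lt_kl lt_l ek /(nth_free play_h (leqnn l) lt_l).
rewrite !inE => /andP[/claimedP[]]; exists k; last by rewrite nth_take.
by rewrite size_take lt_l.
Qed.

Lemma nth_K_edges h i e : play a b h -> i < size h ->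
  e \in nth set0 h i -> #|e| = 2.
Proof.
move=> play_h lt_i /(nth_free play_h (leqnn i) lt_i).
by rewrite !inE => /andP[_ /eqP].
Qed.

Lemma over_claimed h e : game_over h -> #|e| = 2 ->
  exists2 i, i < size h & e \in nth set0 h i.
Proof.
move=> over card_e; apply/claimedP; apply: contraT => unclaimed.
by have := in_set0 e; rewrite -over !inE unclaimed card_e eqxx.
Qed.

End Turns.

Section UnitBias.

Variable n : nat.
Implicit Types (h : history n) (e : {set 'I_n}).

Lemma legal_unit h m : ~ game_over h -> legal_move 1 1 h m <->
  exists2 e, e \in free h & m = [set e].
Proof.
move=> /eqP not_over.
have card1 : minn (bias 1 1 (to_move h)) #|free h| = 1.
  by case: (to_move h); apply/minn_idPl; rewrite card_gt0.
rewrite /legal_move card1; split=> [[sub /eqP/cards1P[e def_m]]|[e free_e ->]].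
  by exists e => //; apply: (subsetP sub); rewrite def_m set11.
by rewrite sub1set cards1.
Qed.

Lemma turn_singleton h i : play 1 1 h -> i < size h ->
  exists e, nth set0 h i = [set e].
Proof.
move=> play_h lt_i; have [not_over] := play_legal play_h lt_i.
by move=> /(legal_unit _ not_over)[e _ ->]; exists e.
Qed.

(** A unit-bias turn claims exactly one new edge, so the turns inject into the
    edges of the complete graph. *)
Lemma size_play h : play 1 1 h -> size h <= 'C(n, 2).
Proof.
move=> play_h.
suff <-: #|claimed h| = size h.
  rewrite -[n in 'C(n, _)]card_ord -card_draws; apply: subset_leq_card.
  apply/subsetP => e /claimedP[i lt_i ei].
  by rewrite inE (nth_K_edges play_h lt_i ei).
elim: play_h => [|{}h m _ IHh not_over /(legal_unit _ not_over)[e + ->]].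
  by rewrite /claimed big_nil cards0.
rewrite !inE => /andP[unclaimed _].
rewrite /claimed -cats1 big_cat big_seq1 /= -/(claimed h) setUC cardsU1 unclaimed.
by rewrite IHh size_cat addnC.
Qed.

(** Preferring [good] moves when there are some, and any free edge otherwise,
    is always legal; every strategy below has this form. *)
Definition prefer (good : history n -> pred {set 'I_n}) : strategy n := fun h =>
  if [pick e in free h | good h e] is Some e then [set e]
  else if [pick e in free h] is Some e then [set e] else set0.

Lemma prefer_valid P good : valid_strategy 1 1 P (prefer good).
Proof.
move=> h _ not_over _; apply/legal_unit => //; rewrite /prefer.
case: pickP => [e /andP[free_e _]|_]; first by exists e.
case: pickP => [e free_e|free0]; first by exists e.
by case: not_over; apply/setP => e; rewrite free0 inE.
Qed.

Lemma prefer_good (good : history n -> pred {set 'I_n}) h e :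
    e \in free h -> good h e ->
  exists2 e', good h e' & prefer good h = [set e'].
Proof.
move=> free_e good_e; rewrite /prefer; case: pickP => [e' /andP[_ ge']|none].
  by exists e'.
by have := none e; rewrite free_e good_e.
Qed.

End UnitBias.

(** * At most three vertices *)

Lemma diameter_le_small_play n (h : history n) :
  n <= 3 -> play 1 1 h -> game_over h -> diameter_le (maker_graph h) 2.
Proof.
move=> le_n3 play_h over u v.
have [<-|neq_uv] := eqVneq u v; first by exists [::].
have card_uv : #|[set u; v]| = 2 by rewrite cards2 neq_uv.
have [i lt_i uv_i] := over_claimed over card_uv.
have [odd_i|even_i] := boolP (odd i); last first.
  exists [:: v]; split=> //=; rewrite andbT; apply/maker_edgesP.
  by exists i.
(* Breaker owns [uv], so he has moved, which requires at least two edges. *)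
have n3 : n = 3.
  have := leq_trans lt_i (size_play play_h).
  by case: n le_n3 {h play_h over u v neq_uv card_uv lt_i uv_i}
    => [|[|[|[|?]]]] //; case: i odd_i => [|[]].
have size3 : size h <= 3 by rewrite (leq_trans (size_play play_h)) // n3.
have /subsetPn[w _ w_uv] : ~~ ([set: 'I_n] \subset [set u; v]).
  by apply/negP => /subset_leq_card; rewrite card_uv cardsT card_ord n3.
have maker_w x : x \in [set u; v] -> [set x; w] \in maker_edges h.
  move=> x_uv; have neq_xw : x != w by apply: contraNneq w_uv => <-.
  have card_xw : #|[set x; w]| = 2 by rewrite cards2 neq_xw.
  have [j lt_j xw_j] := over_claimed over card_xw.
  apply/maker_edgesP; exists j; split=> //; apply/negP => odd_j.
  (* Turn 1 is the only turn of Breaker, and it claims a single edge. *)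
  have eq_ij : j = i.
    move: (leq_trans lt_i size3) (leq_trans lt_j size3) odd_i odd_j.
    by case: i {lt_i uv_i} => [|[|[]]] //; case: j {lt_j xw_j} => [|[|[]]].
  have [e def_e] := turn_singleton play_h lt_i.
  move: xw_j uv_i; rewrite eq_ij def_e !inE => /eqP <- /eqP uv_xw.
  by case/negP: w_uv; rewrite uv_xw set22.
exists [:: w; v]; split=> //=; apply/and3P; split=> //.
  by apply: maker_w; rewrite set21.
by rewrite /maker_graph /= setUC; apply: maker_w; rewrite set22.
Qed.

(** * The pairing strategy *)

Section Pairing.

Variable n : nat.
Implicit Types (h : history n) (e f : {set 'I_n}).

Definition symdiff f e := (f :\: e) :|: (e :\: f).

Lemma symdiff_pair (u v w : 'I_n) : u != v -> w != u -> w != v ->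
  symdiff [set u; v] [set u; w] = [set v; w].
Proof.
move=> neq_uv neq_wu neq_wv; apply/setP => x; rewrite !inE.
have [->|] := eqVneq x u; first by rewrite (negPf neq_uv) eq_sym (negPf neq_wu).
have [->|] := eqVneq x v; first by rewrite [v == w]eq_sym (negPf neq_wv).
by rewrite andbF.
Qed.

(** A turn of a unit-bias game is a singleton [[set e]], so that its cover is the
    edge [e]. Turn 1 is Breaker's first, which fixes the pairing. When Maker's
    last edge does not meet it, the symmetric difference has four elements: it
    is no free edge, and Breaker may play anywhere. *)
Definition pairing_good h e :=
  if size h == 1 then [disjoint e & cover (nth set0 h 0)]
  else e == symdiff (cover (nth set0 h 1)) (cover (last set0 h)).

Notation pairing := (prefer pairing_good).

Lemma cover_set1 e : cover [set e] = e.
Proof. by rewrite /cover big_set1. Qed.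

Lemma disjoint_edge_exists e : 4 <= n -> #|e| = 2 ->
  exists2 f : {set 'I_n}, #|f| = 2 & [disjoint f & e].
Proof.
move=> n4 card_e.
have /card_geqP[s [uniq_s size_s sub_s]] : 2 <= #|~: e|.
  by rewrite cardsCs setCK card_ord card_e (leq_sub2r 2 n4).
exists [set:: s]; first by rewrite cardsE (card_uniqP uniq_s).
apply/pred0P => x /=; rewrite inE; apply/negP => /andP[/sub_s].
by rewrite inE => /negPf->.
Qed.

(** Existence of the two opening turns and success of the first reply: an edge
    disjoint from Maker's opening edge is claimed at the end of the play, hence
    after turn 0, so it was free when Breaker first moved. *)
Lemma pairing_opening h : 4 <= n -> play 1 1 h -> game_over h ->
    consistent Breaker pairing h ->
  exists e f, [/\ 1 < size h, nth set0 h 0 = [set e], nth set0 h 1 = [set f]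
                & [disjoint f & e]].
Proof.
move=> n4 play_h over cons.
have size_gt0 : 0 < size h.
  have : 0 < #|[set A : {set 'I_n} | #|A| == 2]|.
    by rewrite card_draws card_ord bin_gt0 (ltn_trans _ n4).
  case/card_gt0P => e; rewrite inE => /eqP card_e.
  by have [i /(leq_ltn_trans (leq0n i))] := over_claimed over card_e.
have [e def_e] := turn_singleton play_h size_gt0.
have card_e : #|e| = 2.
  by apply: (nth_K_edges play_h size_gt0); rewrite def_e set11.
have [f card_f disj_f] := disjoint_edge_exists n4 card_e.
have [i lt_i fi] := over_claimed over card_f.
have i_gt0 : 0 < i.
  rewrite lt0n; apply/eqP => i0; move: fi disj_f; rewrite i0 def_e inE.
  by move=> /eqP ->; rewrite -setI_eq0 setIid -cards_eq0 card_e.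
have size_gt1 : 1 < size h := leq_ltn_trans i_gt0 lt_i.
have size_take1 : size (take 1 h) = 1 by rewrite size_take size_gt1.
have good_f : pairing_good (take 1 h) f.
  by rewrite /pairing_good size_take1 eqxx nth_take // def_e cover_set1.
have [g] := prefer_good (nth_free play_h i_gt0 lt_i fi) good_f.
rewrite /pairing_good size_take1 eqxx nth_take // def_e cover_set1 => disj_g.
rewrite -cons // => [def_g|]; last by rewrite /to_move size_take1.
by exists e, g.
Qed.

(** Breaker answers in turn [i.+1], where the partner [e'] of Maker's edge [e] is
    still free, since Maker claims it only in turn [j]: a contradiction. *)
Lemma pairing_blocks h f e e' i j : play 1 1 h ->
    consistent Breaker pairing h -> nth set0 h 1 = [set f] ->
    ~~ odd i -> ~~ odd j -> 0 < i -> i < j -> j < size h ->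
    e \in nth set0 h i -> e' \in nth set0 h j -> symdiff f e = e' -> False.
Proof.
move=> play_h cons def_f even_i even_j i_gt0 lt_ij lt_j ei ej def_e'.
have lt_i := ltn_trans lt_ij lt_j.
have lt_i1 : i.+1 < size h := leq_ltn_trans lt_ij lt_j.
have size_i1 : size (take i.+1 h) = i.+1 by rewrite size_take lt_i1.
have turn_e : nth set0 h i = [set e].
  have [x def_x] := turn_singleton play_h lt_i.
  by move: ei; rewrite def_x inE => /eqP ->.
have last_i : last set0 (take i.+1 h) = [set e].
  by rewrite -nth_last size_i1 nth_take.
have goodE x : pairing_good (take i.+1 h) x = (x == e').
  rewrite /pairing_good size_i1 eqSS (gtn_eqF i_gt0) last_i nth_take // def_f.
  by rewrite !cover_set1 def_e'.
have good_e' : pairing_good (take i.+1 h) e' by rewrite goodE.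
have [x] := prefer_good (nth_free play_h lt_ij lt_j ej) good_e'.
rewrite goodE => /eqP ->; rewrite -cons // => [reply|]; last first.
  by rewrite /to_move size_i1 /= even_i.
have e'_i1 : e' \in nth set0 h i.+1 by rewrite reply set11.
have := turn_disjoint play_h lt_i1 lt_j e'_i1 ej.
by move=> eq_j; move: even_j; rewrite -eq_j /= even_i.
Qed.

Lemma pairing_wins h : 4 <= n -> play 1 1 h -> game_over h ->
  consistent Breaker pairing h -> ~ diameter_le (maker_graph h) 2.
Proof.
move=> n4 play_h over cons diam.
have [e [f [size_gt1 def_e def_f disj]]] := pairing_opening n4 play_h over cons.
have f_1 : f \in nth set0 h 1 by rewrite def_f set11.
have /eqP/cards2P[u [v [neq_uv def_uv]]] := nth_K_edges play_h size_gt1 f_1.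
have not_uv : [set u; v] \notin maker_edges h.
  apply/maker_edgesP => -[i [lt_i even_i]]; rewrite -def_uv => f_i.
  by move: even_i; rewrite (turn_disjoint play_h lt_i size_gt1 f_i f_1).
(* Maker's opening edge misses [u] and [v], so he touches them only later. *)
have maker_late x w i : x \in f -> [set x; w] \in nth set0 h i -> 0 < i.
  move=> x_f xw_i; rewrite lt0n; apply/eqP => i0; move: xw_i.
  rewrite i0 def_e inE => /eqP xw_e.
  by have /pred0P/(_ x) := disj; rewrite /= x_f -xw_e set21.
have [[|w [|x [|y p]]] []] := diam u v => //=.
- by move=> _ eq_uv; rewrite eq_uv eqxx in neq_uv.
- by rewrite andbT => + eq_wv; rewrite eq_wv /maker_graph /= (negPf not_uv).
rewrite andbT /maker_graph /= => /andP[+ +] eq_xv _.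
rewrite eq_xv [[set w; v]]setUC => /maker_edgesP[i [lt_i even_i uw_i]].
move=> /maker_edgesP[j [lt_j even_j vw_j]].
have neq_wu : w != u.
  have := nth_K_edges play_h lt_i uw_i; rewrite cards2 eq_sym.
  by case: eqVneq.
have neq_wv : w != v.
  have := nth_K_edges play_h lt_j vw_j; rewrite cards2 eq_sym.
  by case: eqVneq.
have u_f : u \in f by rewrite def_uv set21.
have v_f : v \in f by rewrite def_uv set22.
have [lt_ij|lt_ji|eq_ij] := ltngtP i j.
- apply: (pairing_blocks play_h cons def_f even_i even_j _ lt_ij lt_j uw_i vw_j).
    exact: maker_late u_f uw_i.
  by rewrite def_uv symdiff_pair.
- apply: (pairing_blocks play_h cons def_f even_j even_i _ lt_ji lt_i vw_j uw_i).
    exact: maker_late v_f vw_j.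
  by rewrite def_uv setUC symdiff_pair // eq_sym.
have [g def_g] := turn_singleton play_h lt_i.
move: uw_i vw_j; rewrite -eq_ij def_g !inE => /eqP <- /eqP/setP/(_ u).
by rewrite !inE eqxx (negPf neq_uv) eq_sym (negPf neq_wu).
Qed.

End Pairing.

Theorem proposition2 (n : nat) (hn : 0 < n) :
  (n <= 3 -> has_winning_strategy n 1 1 2 Maker) /\
  (4 <= n -> has_winning_strategy n 1 1 2 Breaker).
Proof.
split=> [n3|n4].
  exists (prefer (fun _ => predT)); split; first exact: prefer_valid.
  by move=> h play_h over _; apply: diameter_le_small_play.
exists (prefer (@pairing_good n)); split; first exact: prefer_valid.
by move=> h play_h over cons; apply: pairing_wins.
Qed.
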